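(* Let $G$ be a Hausdorff topological group and let $K$ be a subgroup of $G$. Then the functor $G\times_K-:\mathcal{PA}_K\to\mathcal{A}_G$ is left adjoint to the restriction functor $\mathrm{res}^G_K:\mathcal{A}_G\to\mathcal{PA}_K$.
   Context: Partial actions. A partial action of a group $G$ (identity $e$) on a set $X$ is a map $\theta:G*X\to X$, $(g,x)\mapsto g\cdot x$, defined on a subset $G*X\subseteq G\times X$ (write $\exists\, g\cdot x$ for $(g,x)\in G*X$), such that for all $g,h\in G$, $x\in X$: (PA1) if $\exists\, g\cdot x$ then $\exists\, g^{-1}\cdot(g\cdot x)$ and $g^{-1}\cdot(g\cdot x)=x$; (PA2) if $\exists\, g\cdot(h\cdot x)$ then $\exists\,(gh)\cdot x$ and $g\cdot(h\cdot x)=(gh)\cdot x$; (PA3) $\exists\, e\cdot x$ and $e\cdot x=x$. It is global if $G*X=G\times X$. Put $X_g=\{x\in X:\exists\, g^{-1}\cdot x\}$, $\theta_g:X_{g^{-1}}\to X_g$, $x\mapsto g\cdot x$, and $G^x=\{g\in G:(g,x)\in G*X\}$. If $G$ is a topological group and $X$ a topological space, $\theta$ is topological if every $X_g$ is open in $X$ and every $\theta_g$ is a homeomorphism, and continuous if $\theta$ is continuous for the subspace topology on $G*X\subseteq G\times X$. All topological groups are Hausdorff and all partial actions are topological. A $G$-space is a pair $(X,\theta)$ with $\theta$ a continuous (topological) partial action of $G$ on the topological space $X$. A $G$-map $f:(X,\theta)\to(Y,\eta)$ is a continuous map such that for all $(g,x)\in G*X$ one has $(g,f(x))\in G*Y$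 and $\eta(g,f(x))=f(\theta(g,x))$. Categories. $\mathcal{PA}_G$ is the category of $G$-spaces and $G$-maps; $\mathcal{A}_G$ is its full subcategory of $G$-spaces with global action. Twisted product. For a subgroup $K\le G$ (subspace topology) and a $K$-space $(X,\theta)$, $G\times_KX$ is the quotient space (quotient topology) of $G\times X$ by the equivalence relation whose classes are $[g,x]_K=\{(gk^{-1},\theta(k,x)):k\in K^x\}$, where $K^x=\{k\in K:(k,x)\in K*X\}$. The group $G$ acts on it globally and continuously by $g'\cdot[g,x]_K=[g'g,x]_K$. Functors. $G\times_K-$ sends $(X,\theta)$ to $G\times_KX$ with this action, and a $K$-map $f:X\to Y$ to $G\times_Kf:[g,x]_K\mapsto[g,f(x)]_K$. $\mathrm{res}^G_K$ sends a global $G$-space to the same space with the action restricted to $K$, and a $G$-map to itself. *)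

(* Defs.v *)
From HB Require Import structures.
From mathcomp Require Import all_boot all_classical topology.

Set Implicit Arguments.
Unset Strict Implicit.
Unset Printing Implicit Defensive.

Local Open Scope classical_set_scope.
Local Open Scope quotient_scope.
Local Open Scope group_scope.

Record category := Category {
  obj :> Type;
  hom : obj -> obj -> Type;
  idm : forall a, hom a a;
  cmp : forall a b c, hom b c -> hom a b -> hom a c;
  cmp_idl : forall a b (f : hom a b), cmp (idm b) f = f;
  cmp_idr : forall a b (f : hom a b), cmp f (idm a) = f;
  cmpA : forall a b c d (h : hom c d) (g : hom b c) (f : hom a b),
    cmp h (cmp g f) = cmp (cmp h g) f
}.
Arguments hom {_} _ _.
Arguments idm {_} _.
Arguments cmp {_ _ _ _} _ _.

Record functor (C D : category) := Functor {
  fobj :> C -> D;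
  fmap : forall a b : C, hom a b -> hom (fobj a) (fobj b);
  fmap_id : forall a : C, fmap (idm a) = idm (fobj a);
  fmap_cmp : forall (a b c : C) (g : hom b c) (f : hom a b),
    fmap (cmp g f) = cmp (fmap g) (fmap f)
}.
Arguments fmap {_ _} _ {_ _} _.

Definition left_adjoint (C D : category) (F : functor C D) (R : functor D C) :
    Prop :=
  exists phi : forall (x : C) (y : D), hom (F x) y -> hom x (R y),
    [/\ forall (x : C) (y : D), bijective (@phi x y),
        forall (x x' : C) (y : D) (u : hom x' x) (f : hom (F x) y),
          phi x' y (cmp f (fmap F u)) = cmp (phi x y f) u &
        forall (x : C) (y y' : D) (v : hom y y') (f : hom (F x) y),
          phi x y' (cmp v f) = cmp (fmap R v) (phi x y f)].

Section FullSubcategory.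
Variables (C : category) (P : C -> Prop).

Definition full_subcategory : category :=
  @Category {x : C | P x}
    (fun a b => hom (sval a) (sval b))
    (fun a => idm (sval a))
    (fun _ _ _ g f => cmp g f)
    (fun _ _ f => cmp_idl f)
    (fun _ _ f => cmp_idr f)
    (fun _ _ _ _ h g f => cmpA h g f).

End FullSubcategory.

Section ProductContinuity.
Variables S T U : topologicalType.

Lemma continuous_fst : continuous (@fst S T).
Proof. by move=> p; exact: cvg_fst. Qed.

Lemma continuous_snd : continuous (@snd S T).
Proof. by move=> p; exact: cvg_snd. Qed.

Lemma continuous_at_pair (f : S -> T) (g : S -> U) (s : S) :
  {for s, continuous f} -> {for s, continuous g} ->
  {for s, continuous (fun x => (f x, g x))}.
Proof. by move=> cf cg; exact: (cvg_pair cf cg). Qed.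

End ProductContinuity.

Lemma within_continuousP (S T : topologicalType) (A : set S) (f : S -> T) :
  {within A, continuous f} <->
  forall x, A x -> forall U, nbhs (f x) U -> nbhs x [set y | A y -> U (f y)].
Proof.
rewrite continuous_subspace_in; split=> cf x.
  move=> Ax U nU; have /(_ U nU) := cf x (mem_set Ax).
  by rewrite /nbhs /= -nbhs_subspace_in.
rewrite inE => Ax U nU; have := cf x Ax U nU.
by rewrite nbhs_simpl /= {2}/nbhs /= -nbhs_subspace_in.
Qed.

Lemma within_continuous_preimage (S T U : topologicalType) (A : set T)
    (j : S -> T) (f : T -> U) :
  continuous j -> {within A, continuous f} ->
  {within j @^-1` A, continuous (f \o j)}.
Proof.
move=> cj /within_continuousP cf; apply/within_continuousP => x Ax V nV.
exact: (cj x _ (cf _ Ax V nV)).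
Qed.

HB.mixin Record Group_isTopologicalGroup G & Topological G & Group G := {
  mulg_continuous : continuous (fun p : G * G => p.1 * p.2);
  invg_continuous : continuous (fun g : G => g^-1)
}.

#[short(type="topologicalGroupType")]
HB.structure Definition TopologicalGroup :=
  {G of Topological G & Group G & Group_isTopologicalGroup G}.

(* [groupClosed G] is a boolean predicate on [G]; by classical logic these are
   all the subgroups of [G]. *)
Definition subgroup_of (G : topologicalGroupType) (K : groupClosed G) : Type :=
  {g : G | g \in K}.

Section Subgroup.
Variables (G : topologicalGroupType) (K : groupClosed G).

HB.instance Definition _ := SubChoice.on (subgroup_of K).

Lemma subgroup_group_closed : group_closed K.
Proof. by split; [exact: gpred1 | exact: gpredF]. Qed.

HB.instance Definition _ :=
  SubChoice_isSubGroup.Build G _ (subgroup_of K) subgroup_group_closed.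

HB.instance Definition _ := Topological.copy (subgroup_of K)
  (initial_topology (\val : subgroup_of K -> G)).

Lemma subgroup_val_continuous : continuous (\val : subgroup_of K -> G).
Proof. exact: initial_continuous. Qed.

Lemma subgroup_val1 : \val (1 : subgroup_of K) = 1.
Proof. by []. Qed.

Lemma subgroup_valM (k l : subgroup_of K) : \val (k * l) = \val k * \val l.
Proof. by []. Qed.

Lemma subgroup_valV (k : subgroup_of K) : \val k^-1 = (\val k)^-1.
Proof. by []. Qed.

Lemma subgroup_cvg (T : topologicalType) (f : T -> subgroup_of K) (t : T) :
  {for t, continuous (\val \o f)} -> {for t, continuous f}.
Proof.
move=> cf U /= [V [[W oW <-] /= Wft] VU].
have nW : nbhs ((\val \o f) t) W by exact: open_nbhs_nbhs.
change (nbhs t (f @^-1` U)).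
by apply: (@filterS _ (nbhs t) _ _ _ _ (cf W nW)) => x Wx; exact: VU.
Qed.

Lemma subgroup_mulg_continuous :
  continuous (fun p : subgroup_of K * subgroup_of K => p.1 * p.2).
Proof.
move=> p; apply: subgroup_cvg.
have -> : \val \o (fun p : subgroup_of K * subgroup_of K => p.1 * p.2) =
  (fun q : G * G => q.1 * q.2) \o
  (fun p : subgroup_of K * subgroup_of K => (\val p.1, \val p.2)) by [].
apply: continuous_comp; last exact: mulg_continuous.
apply: continuous_at_pair.
  apply: (@continuous_comp _ _ _ fst (\val : subgroup_of K -> G)).
    exact: continuous_fst.
  exact: subgroup_val_continuous.
apply: (@continuous_comp _ _ _ snd (\val : subgroup_of K -> G)).
  exact: continuous_snd.
exact: subgroup_val_continuous.
Qed.

Lemma subgroup_invg_continuous : continuous (fun k : subgroup_of K => k^-1).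
Proof.
move=> a; apply: subgroup_cvg => /=.
have -> : \val \o (fun k : subgroup_of K => k^-1) =
  (fun g : G => g^-1) \o (\val : subgroup_of K -> G) by [].
apply: continuous_comp; first exact: subgroup_val_continuous.
exact: invg_continuous.
Qed.

HB.instance Definition _ := Group_isTopologicalGroup.Build (subgroup_of K)
  subgroup_mulg_continuous subgroup_invg_continuous.

End Subgroup.

(* The partial map [theta : G * X -> X] is given by its domain [pdom] and a
   total function [pact] whose values outside [pdom] are irrelevant. *)
Record partial_action (G : groupType) (X : Type) := PartialAction {
  pdom : set (G * X);
  pact : G -> X -> X;
  pactV : forall g x, pdom (g, x) ->
    pdom (g^-1, pact g x) /\ pact g^-1 (pact g x) = x;
  pactM : forall g h x, pdom (h, x) -> pdom (g, pact h x) ->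
    pdom (g * h, x) /\ pact g (pact h x) = pact (g * h) x;
  pact1 : forall x, pdom (1, x) /\ pact 1 x = x
}.

Definition global (G : groupType) (X : Type) (theta : partial_action G X) :=
  pdom theta = setT.

Definition pdom_at (G : groupType) (X : Type) (theta : partial_action G X)
  (g : G) : set X := [set x | pdom theta (g^-1, x)].

Definition homeomorphism_on (X : topologicalType) (A B : set X) (f : X -> X) :=
  exists h : X -> X,
    [/\ set_fun A B f, set_fun B A h,
        (forall x, A x -> h (f x) = x) & (forall y, B y -> f (h y) = y)] /\
    {within A, continuous f} /\ {within B, continuous h}.

Definition topological_action (G : groupType) (X : topologicalType)
    (theta : partial_action G X) :=
  forall g, open (pdom_at theta g) /\
    homeomorphism_on (pdom_at theta g^-1) (pdom_at theta g) (pact theta g).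

Definition continuous_action (G : topologicalGroupType) (X : topologicalType)
    (theta : partial_action G X) :=
  {within pdom theta, continuous (fun p : G * X => pact theta p.1 p.2)}.

Record Gspace (G : topologicalGroupType) := MkGspace {
  carrier :> topologicalType;
  action : partial_action G carrier;
  action_topological : topological_action action;
  action_continuous : continuous_action action
}.

Record Gmap (G : topologicalGroupType) (X Y : Gspace G) := MkGmap {
  gmap :> X -> Y;
  gmap_continuous : continuous gmap;
  gmap_equivariant : forall g x, pdom (action X) (g, x) ->
    pdom (action Y) (g, gmap x) /\
    pact (action Y) g (gmap x) = gmap (pact (action X) g x)
}.

Lemma gmap_ext (G : topologicalGroupType) (X Y : Gspace G) (f f' : Gmap X Y) :
  f =1 f' -> f = f'.
Proof.
case: f f' => [f cf ef] [f' cf' ef'] /= /funext e.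
by subst f'; congr MkGmap; exact: Prop_irrelevance.
Qed.

Section GspaceCategory.
Variable G : topologicalGroupType.

Program Definition gmap_id (X : Gspace G) : Gmap X X := @MkGmap G X X id _ _.
Next Obligation. by move=> X x. Qed.
Next Obligation. by []. Qed.

Program Definition gmap_comp (X Y Z : Gspace G) (g : Gmap Y Z) (f : Gmap X Y) :
  Gmap X Z := @MkGmap G X Z (g \o f) _ _.
Next Obligation.
move=> X Y Z g f x; apply: continuous_comp; exact: gmap_continuous.
Qed.
Next Obligation.
move=> X Y Z g f a x dx /=.
have [dy <-] := gmap_equivariant f dx.
by have [dz <-] := gmap_equivariant g dy.
Qed.

Program Definition PA : category :=
  @Category (Gspace G) (@Gmap G) gmap_id gmap_comp _ _ _.
Next Obligation. by move=> X Y f; exact: gmap_ext. Qed.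
Next Obligation. by move=> X Y f; exact: gmap_ext. Qed.
Next Obligation. by move=> X Y Z T h g f; exact: gmap_ext. Qed.

Definition Aglob : category :=
  full_subcategory (fun X : PA => global (action X)).

End GspaceCategory.

Section Restriction.
Variables (G : topologicalGroupType) (K : groupClosed G).

Lemma subgroup_incl_continuous (T : topologicalType) :
  continuous (fun p : subgroup_of K * T => (\val p.1 : G, p.2)).
Proof.
move=> p; apply: (@continuous_at_pair _ _ _
  (fun p : subgroup_of K * T => \val p.1 : G) snd); last exact: continuous_snd.
apply: (@continuous_comp _ _ _ fst (\val : subgroup_of K -> G)).
  exact: continuous_fst.
exact: subgroup_val_continuous.
Qed.

Program Definition res_action (X : Type) (theta : partial_action G X) :
    partial_action (subgroup_of K) X :=
  @PartialAction (subgroup_of K) X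
    [set p | pdom theta (\val p.1, p.2)] (fun k x => pact theta (\val k) x) _ _ _.
Next Obligation. by move=> X theta k x  dk; exact: (pactV dk). Qed.
Next Obligation. by move=> X theta g h x  dh dg; exact: (pactM dh dg). Qed.
Next Obligation. by move=> X theta x ; exact: (pact1 theta x). Qed.

Program Definition res_space (X : Gspace G) : Gspace (subgroup_of K) :=
  @MkGspace _ X (res_action (action X)) _ _.
Next Obligation. by move=> X k; exact: (action_topological X (\val k)). Qed.
Next Obligation.
move=> X.
apply: (@within_continuous_preimage _ _ _ _
  (fun p : subgroup_of K * X => (\val p.1, p.2)) _ _ (@action_continuous _ X)).
exact: subgroup_incl_continuous.
Qed.

Program Definition res_map (X Y : Gspace G) (f : Gmap X Y) :
  Gmap (res_space X) (res_space Y) := @MkGmap _ (res_space X) (res_space Y) f _ _.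
Next Obligation. by move=> X Y f; exact: (@gmap_continuous _ X Y f). Qed.
Next Obligation. by move=> X Y f k x; exact: (@gmap_equivariant _ X Y f). Qed.

Program Definition res : functor (Aglob G) (PA (subgroup_of K)) :=
  @Functor (Aglob G) (PA (subgroup_of K))
    (fun X => res_space (sval X)) (fun X Y f => @res_map (sval X) (sval Y) f) _ _.
Next Obligation. by move=> X; exact: gmap_ext. Qed.
Next Obligation. by move=> X Y Z g f; exact: gmap_ext. Qed.

End Restriction.

Section TwistedProduct.
Variables (G : topologicalGroupType) (K : groupClosed G).
Variable X : Gspace (subgroup_of K).

Definition twisted_class (p : G * X) : set (G * X) :=
  [set (p.1 * (\val k)^-1, pact (action X) k p.2) |
    k in [set k : subgroup_of K | pdom (action X) (k, p.2)]].

Definition twisted_rel (p q : G * X) : bool := `[< twisted_class p q >].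

Lemma twisted_rel_refl : reflexive twisted_rel.
Proof.
move=> [g x]; apply/asboolP; have [d1 e1] := pact1 (action X) x.
by exists 1 => //=; rewrite e1 invg1 mulg1.
Qed.

Lemma twisted_rel_sym : symmetric twisted_rel.
Proof.
suff H p q : twisted_rel p q -> twisted_rel q p.
  by move=> p q; apply/idP/idP; exact: H.
case: p => g x /asboolP[k /= dk <-]; apply/asboolP.
have [d e] := pactV dk; exists k^-1 => //=.
by rewrite e -mulgA invgK mulVg mulg1.
Qed.

Lemma twisted_rel_trans : transitive twisted_rel.
Proof.
move=> q [g x] r /asboolP[k /= dk <-] /asboolP[l /= dl <-]; apply/asboolP.
have [d e] := pactM dk dl; exists (l * k) => //=.
by rewrite e invgM mulgA.
Qed.

Canonical twisted_equiv :=
  EquivRel twisted_rel twisted_rel_refl twisted_rel_sym twisted_rel_trans.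

Definition twisted : topologicalType :=
  quotient_topology {eq_quot twisted_equiv}.

Definition twisted_pi (p : G * X) : twisted := \pi_twisted p.

Lemma twisted_piP (p q : G * X) :
  twisted_pi p = twisted_pi q <-> twisted_class p q.
Proof.
by split=> [/eqquotP/asboolP | pq]; [|apply/eqquotP/asboolP].
Qed.

Lemma twisted_reprK (q : twisted) : twisted_pi (repr q) = q.
Proof. exact: reprK. Qed.

Lemma twisted_pi_continuous : continuous twisted_pi.
Proof. exact: pi_continuous. Qed.

Lemma twisted_continuous (T : topologicalType) (f : twisted -> T) :
  continuous (f \o twisted_pi) -> continuous f.
Proof. by move/quotient_continuous. Qed.

Lemma twisted_pi_open (W : set (G * X)) : open W -> open (twisted_pi @` W).
Proof.
move=> oW; change (open (twisted_pi @^-1` (twisted_pi @` W))).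
pose shift (k : subgroup_of K) (p : G * X) : G * X :=
  (p.1 * (\val k)^-1, pact (action X) k p.2).
have -> : twisted_pi @^-1` (twisted_pi @` W) =
    \bigcup_k [set p | pdom (action X) (k, p.2) /\ W (shift k p)].
  apply/seteqP; split=> [p [r Wr /esym/twisted_piP[k dk e]]|p [k _ [dk Wk]]].
    by exists k => //; split=> //; rewrite /shift e.
  by exists (shift k p) => //; apply/esym/twisted_piP; exists k.
apply: bigcup_open => k _.
have [oX _] := action_topological X k^-1.
have [_ [h [_ [ck _]]]] := action_topological X k.
rewrite openE => -[g x] /= [dk Wk].
have nD : nbhs x (pdom_at (action X) k^-1).
  by apply: open_nbhs_nbhs; split=> //; rewrite /pdom_at /= invgK.
have cs : {for (g, x), continuous (shift k)}.
  apply: (@continuous_at_pair _ _ _ (fun p : G * X => p.1 * (\val k)^-1 : G)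
     (fun p : G * X => pact (action X) k p.2)).
    apply: (@continuous_comp _ _ _ (fun p : G * X => (p.1, (\val k)^-1 : G))
      (fun p : G * G => p.1 * p.2)); last exact: mulg_continuous.
    apply: (@continuous_at_pair _ _ _ fst (fun=> (\val k)^-1 : G)).
      exact: continuous_fst.
    exact: cst_continuous.
  apply: (@continuous_comp _ _ _ snd (pact (action X) k)).
    exact: continuous_snd.
  move: ck; rewrite continuous_open_subspace // => ck.
  by apply: ck; rewrite inE; exact: nbhs_singleton nD.
have nW : nbhs (g, x) (shift k @^-1` W).
  by apply: cs; exact: open_nbhs_nbhs.
have nD' : nbhs (g, x) (snd @^-1` pdom_at (action X) k^-1).
  exact: (@continuous_snd G X (g, x) _ nD).
apply: filterS2 nW nD' => -[g' x'] Wk' /=.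
by rewrite /pdom_at /= invgK => dk'; split.
Qed.

Definition twisted_act (g : G) (q : twisted) : twisted :=
  twisted_pi (g * (repr q).1, (repr q).2).

Lemma twisted_actE (g : G) (p : G * X) :
  twisted_act g (twisted_pi p) = twisted_pi (g * p.1, p.2).
Proof.
have /twisted_piP [k dk e] := esym (twisted_reprK (twisted_pi p)).
by apply/esym/twisted_piP; exists k => //; rewrite -e /= mulgA.
Qed.

Lemma twisted_act1 (q : twisted) : twisted_act 1 q = q.
Proof.
by rewrite -[q]twisted_reprK twisted_actE mul1g -surjective_pairing.
Qed.

Lemma twisted_actM (g h : G) (q : twisted) :
  twisted_act g (twisted_act h q) = twisted_act (g * h) q.
Proof. by rewrite -[q]twisted_reprK !twisted_actE mulgA. Qed.

Lemma twisted_act_continuous :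
  continuous (fun p : G * twisted => twisted_act p.1 p.2).
Proof.
move=> [g q] U nU.
pose m (r : G * (G * X)) : G * X := (r.1 * r.2.1, r.2.2).
have cm : continuous (twisted_pi \o m).
  move=> r; apply: continuous_comp; last exact: twisted_pi_continuous.
  apply: (@continuous_at_pair _ _ _ (fun r : G * (G * X) => r.1 * r.2.1 : G)
     (fun r : G * (G * X) => r.2.2)).
    apply: (@continuous_comp _ _ _ (fun r : G * (G * X) => (r.1, r.2.1))
      (fun p : G * G => p.1 * p.2)); last exact: mulg_continuous.
    apply: (@continuous_at_pair _ _ _ fst (fun r : G * (G * X) => r.2.1)).
      exact: continuous_fst.
    apply: (@continuous_comp _ _ _ snd fst); first exact: continuous_snd.
    exact: continuous_fst.
  apply: (@continuous_comp _ _ _ snd snd); exact: continuous_snd.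
have /= nU' : nbhs (twisted_pi (m (g, repr q))) U by exact: nU.
have [[V W] /= [nV nW] VW] := cm (g, repr q) _ nU'.
move: nW; rewrite nbhsE => -[W' [oW' W'q] W'W].
exists (V, twisted_pi @` W') => /=.
  split=> //; apply: (@open_nbhs_nbhs twisted q); split.
    exact: twisted_pi_open.
  by exists (repr q) => //; exact: twisted_reprK.
move=> [g' _] /= [Vg' [r W'r <-]]; rewrite twisted_actE.
exact: (VW (g', r) (conj Vg' (W'W _ W'r))).
Qed.

Program Definition twisted_action : partial_action G twisted :=
  @PartialAction G twisted setT twisted_act _ _ _.
Next Obligation.
by move=> g q _; rewrite twisted_actM mulVg twisted_act1.
Qed.
Next Obligation. by move=> g h q _ _; rewrite twisted_actM. Qed.
Next Obligation. by move=> q; rewrite twisted_act1. Qed.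

Program Definition twisted_space : Gspace G :=
  @MkGspace G twisted twisted_action _ _.
Next Obligation.
have ca (g : G) : continuous (twisted_act g).
  move=> q; apply: (@continuous_comp _ _ _ (fun q : twisted => (g, q))
    (fun p : G * twisted => twisted_act p.1 p.2));
    last exact: twisted_act_continuous.
  apply: (@continuous_at_pair _ _ _ (fun=> g) id); first exact: cst_continuous.
  by [].
move=> g; split; first exact: openT.
exists (twisted_act g^-1); split; first split=> // q _ /=.
- by rewrite twisted_actM mulVg twisted_act1.
- by rewrite twisted_actM mulgV twisted_act1.
by split; apply: continuous_subspaceT; exact: ca.
Qed.
Next Obligation.
by apply: continuous_subspaceT; exact: twisted_act_continuous.
Qed.

Lemma twisted_global : global (action twisted_space).
Proof. by []. Qed.

End TwistedProduct.

Section TwistedFunctor.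
Variables (G : topologicalGroupType) (K : groupClosed G).

Definition twisted_fun (X Y : Gspace (subgroup_of K)) (f : X -> Y)
    (q : twisted X) : twisted Y :=
  twisted_pi ((repr q).1, f (repr q).2).

Lemma twisted_funE (X Y : Gspace (subgroup_of K)) (f : Gmap X Y) (p : G * X) :
  twisted_fun f (twisted_pi p) = twisted_pi (p.1, f p.2).
Proof.
have /twisted_piP [k dk e] := esym (twisted_reprK (twisted_pi p)).
have [dfk efk] := gmap_equivariant f dk.
by apply/esym/twisted_piP; exists k => //; rewrite /= efk -e.
Qed.

Program Definition twisted_map (X Y : Gspace (subgroup_of K)) (f : Gmap X Y) :
  Gmap (twisted_space X) (twisted_space Y) :=
  @MkGmap G (twisted_space X) (twisted_space Y) (twisted_fun f) _ _.
Next Obligation.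
move=> X Y f; apply: twisted_continuous.
have -> : twisted_fun f \o @twisted_pi _ _ X =
    @twisted_pi _ _ Y \o (fun p : G * X => (p.1, f p.2)).
  by apply/funext => p /=; rewrite twisted_funE.
move=> p; apply: continuous_comp; last exact: twisted_pi_continuous.
apply: (@continuous_at_pair _ _ _ fst (fun p : G * X => f p.2)).
  exact: continuous_fst.
apply: (@continuous_comp _ _ _ snd f); first exact: continuous_snd.
exact: (@gmap_continuous _ X Y f).
Qed.
Next Obligation.
move=> X Y f g q _; split=> //=.
by rewrite -[q]twisted_reprK twisted_actE !twisted_funE twisted_actE.
Qed.

Program Definition twisted_product : functor (PA (subgroup_of K)) (Aglob G) :=
  @Functor (PA (subgroup_of K)) (Aglob G)
    (fun X => exist _ (twisted_space X) (twisted_global X))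
    (fun X Y f => twisted_map f) _ _.
Next Obligation.
move=> X; apply: gmap_ext => q /=.
by rewrite -[q]twisted_reprK (twisted_funE (gmap_id X)) -surjective_pairing.
Qed.
Next Obligation.
move=> X Y Z g f; apply: gmap_ext => q /=.
rewrite -[q]twisted_reprK (twisted_funE (gmap_comp g f)).
by rewrite (twisted_funE f) (twisted_funE g).
Qed.

End TwistedFunctor.

(* Main.v *)
(** The unit of the adjunction is [x |-> [1, x]], and a [K]-map [f : X -> Y]
    into a global [G]-space extends uniquely to the [G]-map
    [[g, x] |-> g . f x]; this is well defined because
    [(g k^-1) . f (k . x) = (g k^-1) . (k . f x) = g . f x]. *)

Require Import Defs.
From mathcomp Require Import all_boot all_classical topology.

Set Implicit Arguments.
Unset Strict Implicit.
Unset Printing Implicit Defensive.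

Local Open Scope classical_set_scope.
Local Open Scope group_scope.

Section GlobalAction.
Variables (G : topologicalGroupType) (Y : Gspace G).
Hypothesis gY : global (action Y).

Lemma global_pdom (g : G) (y : Y) : pdom (action Y) (g, y).
Proof. by rewrite gY. Qed.

Lemma global_pactM (g h : G) (y : Y) :
  pact (action Y) g (pact (action Y) h y) = pact (action Y) (g * h) y.
Proof. by have [] := pactM (global_pdom h y) (global_pdom g _). Qed.

(** The domain is all of [G * Y], so the guard in the within-continuity can be discharged at every
    nearby point. This form composes with maps into [G * Y]. *)
Lemma global_pact_continuous :
  continuous (fun p : G * Y => pact (action Y) p.1 p.2).
Proof.
have /within_continuousP cY := @action_continuous _ Y.
move=> -[g y] U nU; have := cY _ (global_pdom g y) U nU.
by apply: filterS => -[h z]; apply; exact: global_pdom.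
Qed.

End GlobalAction.

Section Adjunction.
Variables (G : topologicalGroupType) (K : groupClosed G).
Variable X : Gspace (subgroup_of K).

Lemma twisted_unit_continuous : continuous (fun x : X => twisted_pi (1 : G, x)).
Proof.
move=> x; apply: (@continuous_comp _ _ _ (fun x : X => (1 : G, x))
  (@twisted_pi _ _ X)); last exact: twisted_pi_continuous.
apply: (@continuous_at_pair _ _ _ (fun=> 1 : G) id); first exact: cst_continuous.
by [].
Qed.

(** Acting by [k] gives [[k, x]], and moving [k] across the class gives [[k k^-1, k . x] =
    [1, k . x]]. The move requires [k . x] to be defined. *)
Lemma twisted_unit_equivariant (k : subgroup_of K) (x : X) :
  pdom (action X) (k, x) ->
  twisted_act (\val k) (twisted_pi (1 : G, x)) =
  twisted_pi (1 : G, pact (action X) k x).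
Proof.
move=> dk; rewrite twisted_actE /= mulg1.
by apply/twisted_piP; exists k => //=; rewrite mulgV.
Qed.

Definition twisted_unit : Gmap X (res_space K (twisted_space X)) :=
  @MkGmap _ X (res_space K (twisted_space X)) _ twisted_unit_continuous
    (fun k x dk => conj I (twisted_unit_equivariant dk)).

Section Extension.
Variable Y : Gspace G.
Hypothesis gY : global (action Y).
Variable f : Gmap X (res_space K Y).

(** Computed on the representative selected by [repr]; [twisted_ext_funE] shows that any other one
    gives the same value. *)
Definition twisted_ext_fun (q : twisted X) : Y :=
  pact (action Y) (repr q).1 (f (repr q).2).

Lemma twisted_ext_funE (p : G * X) :
  twisted_ext_fun (twisted_pi p) = pact (action Y) p.1 (f p.2).
Proof.
(* The representative selected for [[g, x]] has the form [(g k^-1, k . x)] with [k . x] defined. *)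
have /twisted_piP [k dk e] := esym (twisted_reprK (twisted_pi p)).
have [_ /= efk] := gmap_equivariant f dk.
by rewrite /twisted_ext_fun -e /= -efk global_pactM // -mulgA mulVg mulg1.
Qed.

Lemma twisted_ext_continuous : continuous twisted_ext_fun.
Proof.
(* By the universal property of the quotient topology, it is enough to treat [(g, x) |-> g . f x] on
   [G * X]. *)
apply: twisted_continuous.
have -> : twisted_ext_fun \o @twisted_pi _ _ X =
    (fun p : G * Y => pact (action Y) p.1 p.2) \o
    (fun p : G * X => (p.1, f p.2 : Y)).
  by apply/funext => p /=; rewrite twisted_ext_funE.
move=> p; apply: continuous_comp; last exact: global_pact_continuous.
apply: (@continuous_at_pair _ _ _ fst (fun p : G * X => f p.2 : Y)).
  exact: continuous_fst.
apply: (@continuous_comp _ _ _ snd f); first exact: continuous_snd.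
exact: (@gmap_continuous _ _ _ f).
Qed.

Lemma twisted_ext_equivariant (g : G) (q : twisted X) :
  pact (action Y) g (twisted_ext_fun q) = twisted_ext_fun (twisted_act g q).
Proof.
by rewrite -[q]twisted_reprK twisted_actE !twisted_ext_funE global_pactM.
Qed.

Definition twisted_ext : Gmap (twisted_space X) Y :=
  @MkGmap G (twisted_space X) Y _ twisted_ext_continuous
    (fun g q _ => conj (global_pdom gY g _) (twisted_ext_equivariant g q)).

End Extension.

(** This is the uniqueness of the extension: since [[g, x] = g . [1, x]], a [G]-map is determined by
    its values at the points [[1, x]]. *)
Lemma twisted_unitK (Y : Gspace G) (gY : global (action Y)) :
  cancel (fun f : Gmap (twisted_space X) Y =>
            gmap_comp (res_map K f) twisted_unit)
         (twisted_ext gY).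
Proof.
move=> f; apply: gmap_ext => q; rewrite -[q]twisted_reprK /= twisted_ext_funE //=.
have [_ ->] := @gmap_equivariant _ _ _ f (repr q).1 (twisted_pi (1, (repr q).2)) I.
by rewrite /= twisted_actE /= mulg1 -surjective_pairing.
Qed.

(** At [[1, x]] the extension takes the value [1 . f x = f x]. *)
Lemma twisted_extK (Y : Gspace G) (gY : global (action Y)) :
  cancel (twisted_ext gY)
         (fun f : Gmap (twisted_space X) Y =>
            gmap_comp (res_map K f) twisted_unit).
Proof.
move=> f; apply: gmap_ext => x /=; rewrite twisted_ext_funE //=.
by have [] := pact1 (action Y) (f x).
Qed.

End Adjunction.

Theorem theorem3p5 (G : topologicalGroupType) (K : groupClosed G)
    (hG : hausdorff_space G) :
  left_adjoint (twisted_product K) (res K).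
Proof.
exists (fun (X : PA (subgroup_of K)) (Y : Aglob G)
  (f : Gmap (twisted_space X) (sval Y)) =>
    gmap_comp (res_map K f) (twisted_unit X)).
split=> [X [Y gY]|X X' Y u f|X Y Y' v f].
- by exists (twisted_ext gY); [exact: twisted_unitK | exact: twisted_extK].
(* Naturality in [X]: both sides send [x] to [f [1, u x]]. *)
- by apply: gmap_ext => x /=; rewrite (twisted_funE u).
(* Naturality in [Y]: both sides compute to [v (f [1, x])]. *)
- exact: gmap_ext.
Qed.
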